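(* For every integer $n\ge 0$, $$\binom{2n+3}{n+1}C_{n+1}=\sum_{k=0}^{n}\frac{8nk+6n+14k+12}{(2n+2)(2n+3)(2n+4)}\binom{2n+3}{n-k}\binom{2n+4}{n-k+2},$$ $$\binom{2n+1}{n}C_{n+1}=\sum_{k=0}^{n}\frac{2k+2}{(2n+2)(2n+3)}\binom{2n+3}{n-k}\binom{2n+3}{n-k+1},$$ $$\binom{2n+1}{n}C_{n+2}=\sum_{k=0}^{n}\frac{8nk+10n+14k+16}{(2n+2)(2n+3)(2n+4)}\binom{2n+4}{n-k}\binom{2n+3}{n-k+1}.$$
   Context: $C_n=\frac{1}{n+1}\binom{2n}{n}$ is the $n$-th Catalan number. *)

(* Defs.v *)
From mathcomp Require Import all_boot all_order all_algebra.

Set Implicit Arguments.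
Unset Strict Implicit.
Unset Printing Implicit Defensive.

Import GRing.Theory.
Local Open Scope ring_scope.

Definition catalan (n : nat) : rat := (n.+1)%:R^-1 * 'C(2 * n, n)%:R.

(* Main.v *)
Require Import Defs.
From mathcomp Require Import all_boot all_order all_algebra.
From mathcomp Require Import zify ring lra.

(** With the summation index reversed ([j = n - k]), each sum telescopes: its
    summand is, up to a constant factor, the difference
    [C(a, j) C(b, j + r) - C(a, j - 1) C(b, j + r - 1)], where [(a, b, r)] is
    [(2n+2, 2n+3, 2)], [(2n+2, 2n+2, 1)] and [(2n+3, 2n+2, 1)] respectively. *)

Import GRing.Theory Num.Theory.
Local Open Scope ring_scope.

Lemma natr_mul_bin_diag (R : pzRingType) (a j : nat) :
  (a.+1)%:R * 'C(a, j)%:R = (j.+1)%:R * 'C(a.+1, j.+1)%:R :> R.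
Proof. by rewrite -!natrM mul_bin_diag. Qed.

(** With the subtraction taken in the ring, no bound on [j] is needed: beyond [a.+1] both binomials
    vanish. *)
Lemma natr_mul_bin_down (R : pzRingType) (a j : nat) :
  (a.+1)%:R * 'C(a, j)%:R = ((a.+1)%:R - j%:R) * 'C(a.+1, j)%:R :> R.
Proof.
have [le_ja|lt_aj] := leqP j a.+1.
  by rewrite -natrB // -!natrM mul_bin_down.
by rewrite !bin_small ?mulr0 // ltnW.
Qed.

Lemma sum_bin_mul_bin (R : comPzRingType) (a b r m : nat) :
  \sum_(0 <= j < m.+1)
     ((a.+1)%:R * ((b.+1)%:R - r%:R) - j%:R * ((a.+1)%:R + (b.+1)%:R))
     * ('C(a.+1, j)%:R * 'C(b.+1, j + r)%:R)
  = (a.+1)%:R * (b.+1)%:R * ('C(a, m)%:R * 'C(b, m + r)%:R) :> R.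
Proof.
elim: m => [|m IHm].
  rewrite big_nat1 !bin0 add0n.
  by rewrite !mul1r mul0r subr0 -!mulrA -natr_mul_bin_down.
rewrite big_nat_recr //= {}IHm addSn.
have A1 := natr_mul_bin_diag R a m.
have A2 := natr_mul_bin_down R a m.+1.
have B1 := natr_mul_bin_diag R b (m + r).
have B2 := natr_mul_bin_down R b (m + r).+1.
rewrite mulrACA A1 B1 [RHS]mulrACA A2 B2.
rewrite -[(m + r).+1]addn1 -[m.+1]addn1 !natrD.
ring.
Qed.

(** Here [c] is a coefficient as the theorem prints it and [d] the constant relating it, after
    reversal, to the telescoping weight. *)
Lemma sum_bin_mul_bin_rev (F : numFieldType) (a b r n : nat)
    (c : nat -> nat) (d : F) :
  (forall j, (j <= n)%N ->
     (c (n - j)%N)%:R = d * ((a.+1)%:R * ((b.+1)%:R - r%:R)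
                             - j%:R * ((a.+1)%:R + (b.+1)%:R)) :> F) ->
  forall D : nat,
  \sum_(0 <= k < n.+1)
     (c k)%:R / D%:R * 'C(a.+1, n - k)%:R * 'C(b.+1, n - k + r)%:R
  = d / D%:R * ((a.+1)%:R * (b.+1)%:R * ('C(a, n)%:R * 'C(b, n + r)%:R)) :> F.
Proof.
move=> cE D; rewrite -sum_bin_mul_bin mulr_sumr big_nat_rev /=.
apply: eq_big_nat => j /andP[_ lt_jn].
rewrite add0n subSS subKn // cE //; ring.
Qed.

Lemma bin_double_half (n : nat) :
  'C((2 * n).+2, n.+1) = (2 * 'C((2 * n).+1, n))%N.
Proof.
rewrite binS; have -> : 'C((2 * n).+1, n.+1) = 'C((2 * n).+1, n).
  by rewrite -bin_sub; [congr binomial; lia | lia].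
lia.
Qed.

Theorem corollary3p6 (n : nat) :
  [/\ 'C(2 * n + 3, n + 1)%:R * catalan (n + 1) =
        \sum_(0 <= k < n.+1)
           (8 * n * k + 6 * n + 14 * k + 12)%N%:R
           / ((2 * n + 2) * (2 * n + 3) * (2 * n + 4))%N%:R
           * 'C(2 * n + 3, n - k)%:R * 'C(2 * n + 4, n - k + 2)%:R,
      'C(2 * n + 1, n)%:R * catalan (n + 1) =
        \sum_(0 <= k < n.+1)
           (2 * k + 2)%N%:R / ((2 * n + 2) * (2 * n + 3))%N%:R
           * 'C(2 * n + 3, n - k)%:R * 'C(2 * n + 3, n - k + 1)%:R
    & 'C(2 * n + 1, n)%:R * catalan (n + 2) =
        \sum_(0 <= k < n.+1)
           (8 * n * k + 10 * n + 14 * k + 16)%N%:R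
           / ((2 * n + 2) * (2 * n + 3) * (2 * n + 4))%N%:R
           * 'C(2 * n + 4, n - k)%:R * 'C(2 * n + 3, n - k + 1)%:R ].
Proof.
(* Lets [lra] discharge the nonzero denominators left by [field]. *)
have n0 : 0 <= n%:R :> rat by [].
rewrite /catalan.
have -> : (2 * (n + 1) = (2 * n).+2)%N by lia.
have -> : (2 * (n + 2) = (2 * n.+1).+2)%N by lia.
rewrite !addn1 !addn2 !addn3 !addn4.
have sym : 'C((2 * n).+3, n.+2) = 'C((2 * n).+3, n.+1).
  by rewrite -bin_sub; [congr binomial; lia | lia].
(* The ratio of neighbours in one row, used to trade column [n] for column [n.+1]. *)
have mulL (m j : nat) : (j.+1)%:R * 'C(m.+1, j.+1)%:R
    = ((m.+1)%:R - j%:R) * 'C(m.+1, j)%:R :> rat.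
  by rewrite -natr_mul_bin_diag natr_mul_bin_down.
split.
- rewrite (@sum_bin_mul_bin_rev _ (2 * n).+2 (2 * n).+3 2 n
             (fun k => 8 * n * k + 6 * n + 14 * k + 12)%N 2); last first.
    by move=> j le_jn; rewrite !natrD !natrM natrB //; ring.
  have left := mulL (2 * n).+1 n.
  have -> : 'C((2 * n).+2, n)%:R
      = (n.+1)%:R / (n.+2)%:R * 'C((2 * n).+2, n.+1)%:R :> rat.
    rewrite mulrAC left; field; lra.
  rewrite !addn2 sym; field; lra.
(* Both rows are [2n+3], so the weight is [(2n+3)(2(n-j)+2)]; [d] removes the first factor. *)
- rewrite (@sum_bin_mul_bin_rev _ (2 * n).+2 (2 * n).+2 1 n
             (fun k => 2 * k + 2)%N ((2 * n).+3)%:R^-1); last first.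
    by move=> j le_jn; rewrite natrD natrM natrB //; field; lra.
  have down := natr_mul_bin_down rat (2 * n).+1 n.
  have -> : 'C((2 * n).+1, n)%:R
      = (n.+2)%:R / ((2 * n).+2)%:R * 'C((2 * n).+2, n)%:R :> rat.
    apply: (@mulfI _ ((2 * n).+2)%:R); first by rewrite pnatr_eq0.
    rewrite down; field; lra.
  rewrite !addn1; field; lra.
- rewrite (@sum_bin_mul_bin_rev _ (2 * n).+3 (2 * n).+2 1 n
             (fun k => 8 * n * k + 10 * n + 14 * k + 16)%N 2); last first.
    by move=> j le_jn; rewrite !natrD !natrM natrB //; ring.
  have left := mulL (2 * n).+2 n.
  (* Halves the central binomials on both sides: ['C(2n+4, n+2)] from the Catalan number and
     ['C(2n+2, n+1)] from the closed form. Both sides then become multiples of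
     ['C(2n+1, n) * 'C(2n+3, n+1)]. *)
  rewrite addn1 !bin_double_half.
  have -> : (2 * n.+1 = (2 * n).+2)%N by lia.
  have -> : 'C((2 * n).+3, n)%:R
      = (n.+1)%:R / (n.+3)%:R * 'C((2 * n).+3, n.+1)%:R :> rat.
    rewrite mulrAC left; field; lra.
  field; lra.
Qed.
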